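(* Let $m$ be a nonnegative integer and let $a\in(-1,\infty)$ be real. Then $$\int_{0}^{\infty}\frac{dx}{(x^{4}+2ax^{2}+1)^{m+1}}=\frac{\pi}{2^{m+3/2}(a+1)^{m+1/2}}\,P_m(a),$$ where $$P_m(a)=2^{-2m}\sum_{k=0}^{m}2^{k}\binom{2m-2k}{m-k}\binom{m+k}{k}(a+1)^{k}.$$
   Context: The set $\mathbb{N}$ of admissible $m$ includes $0$. *)

(* Defs.v *)
From Stdlib Require Import Reals.
From Coquelicot Require Import Coquelicot.
Open Scope R_scope.

(* [Binomial.C] is qualified because Coquelicot's [C] is the type of complex
   numbers.  The natural-number subtractions are exact: [sum_f_R0 _ m] runs
   over 0 <= k <= m. *)
Definition P (m : nat) (a : R) : R :=
  / 2 ^ (2 * m) *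
  sum_f_R0 (fun k =>
    2 ^ k * Binomial.C (2 * m - 2 * k) (m - k) * Binomial.C (m + k) k
    * (a + 1) ^ k) m.

(* Main.v *)
(** Put b = 2 (a + 1) and t = x - 1/x, so that x^4 + 2 a x^2 + 1 =
    x^2 (t^2 + b).  If F is the antiderivative of the integrand f with
    F 0 = 0, then the derivative of F x - F (1/x) is
    f x + f (1/x) / x^2 = (1 + x^(4m+2)) / (x^4 + 2 a x^2 + 1)^(m+1), and by a
    Chebyshev-type identity this equals
    (dt/dx) sum_j binom(m+j, 2j) t^(2j) / (t^2 + b)^(m+1).
    Hence F x = F (1/x) + H (x - 1/x), where H is the antiderivative in t
    vanishing at 0; letting x tend to infinity, the integral is the limit of H,
    which is a finite sum of Wallis-type integrals, and the two sums agree
    term by term. *)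

Require Import Defs.
From Stdlib Require Import Arith Reals Lra Lia.
From Coquelicot Require Import Coquelicot.
Open Scope R_scope.

(** * Binomial coefficients and the Chebyshev-type sums *)

(* [Binomial.C n k] is [n! / k!] instead of [0] when [n < k]. *)
Definition binom (n k : nat) : R :=
  if Nat.leb k n then Binomial.C n k else 0.

Lemma binom_le n k : (k <= n)%nat -> binom n k = Binomial.C n k.
Proof. now intros H; unfold binom; apply Nat.leb_le in H; rewrite H. Qed.

Lemma binom_gt n k : (n < k)%nat -> binom n k = 0.
Proof. now intros H; unfold binom; apply Nat.leb_gt in H; rewrite H. Qed.

Lemma binom_0_r n : binom n 0 = 1.
Proof. rewrite binom_le by lia; apply C_n_0. Qed.

Lemma binom_pascal n k : binom (S n) (S k) = binom n k + binom n (S k).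
Proof.
  destruct (lt_eq_lt_dec k n) as [[H | ->] | H].
  - rewrite !binom_le by lia; symmetry; now apply pascal.
  - rewrite (binom_gt n (S n)) by lia; rewrite !binom_le, !C_n_n by lia; ring.
  - rewrite !binom_gt by lia; ring.
Qed.

(** The upper limit [N] is kept apart from [m] so that recurrences in [m] do not change the range.
    All terms with [j > m] vanish, so any [N >= m] gives the same value. *)
Definition even_sum (N m : nat) (t : R) : R :=
  sum_f_R0 (fun j => binom (m + j) (2 * j) * t ^ (2 * j)) N.

Definition odd_sum (N m : nat) (t : R) : R :=
  sum_f_R0 (fun j => binom (m + j) (2 * j + 1) * t ^ (2 * j)) N.

Lemma odd_sum_step N m t :
  odd_sum N (S m) t = odd_sum N m t + even_sum N m t.
Proof.
  unfold odd_sum, even_sum; rewrite <- plus_sum; apply sum_eq; intros j _.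
  replace (2 * j + 1)%nat with (S (2 * j)) by lia.
  replace (S m + j)%nat with (S (m + j)) by lia.
  rewrite binom_pascal; ring.
Qed.

(** Pascal's rule on the terms with index at least 1, after shifting the index down by one. The
    shift leaves the top term of the odd sum unmatched; [m < N] makes its binomial coefficient 0. *)
Lemma even_sum_step N m t :
  (m < N)%nat -> even_sum N (S m) t = even_sum N m t + t ^ 2 * odd_sum N (S m) t.
Proof.
  intros H; destruct N as [|N]; [lia|].
  unfold even_sum, odd_sum.
  rewrite (decomp_sum (fun j => binom (S m + j) _ * _)) by lia.
  rewrite (decomp_sum (fun j => binom (m + j) (2 * j) * _)) by lia.
  rewrite tech5, (binom_gt (S m + S N)) by lia.
  rewrite Rmult_0_l, Rplus_0_r, scal_sum; simpl pred.
  change (2 * 0)%nat with 0%nat; rewrite !binom_0_r, Rplus_assoc, <- plus_sum.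
  f_equal; apply sum_eq; intros j _.
  replace (2 * S j)%nat with (S (2 * j + 1)) by lia.
  replace (S m + S j)%nat with (S (S m + j)) by lia.
  replace (m + S j)%nat with (S m + j)%nat by lia.
  rewrite binom_pascal.
  replace (S (2 * j + 1)) with (2 * j + 2)%nat by lia.
  rewrite (pow_add t (2 * j) 2); ring.
Qed.

Lemma even_odd_sum_0 N t : even_sum N 0 t = 1 /\ odd_sum N 0 t = 0.
Proof.
  unfold even_sum, odd_sum; induction N as [|N [IHe IHo]].
  - simpl sum_f_R0; rewrite binom_0_r, binom_gt by lia; simpl; lra.
  - rewrite !tech5, IHe, IHo, !binom_gt by lia; lra.
Qed.

(* With x = e^y these are cosh ((2m+1) y) / cosh y and
   sinh (2 m y) / sinh (2 y) as polynomials in t = 2 sinh y. *)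
Lemma even_odd_sum_closed N m x : x <> 0 -> (m <= N)%nat ->
  (x + / x) * even_sum N m (x - / x) = x ^ (2 * m + 1) + / x ^ (2 * m + 1) /\
  (x - / x) * (x + / x) * odd_sum N m (x - / x) = x ^ (2 * m) - / x ^ (2 * m).
Proof.
  intros Hx; induction m as [|m IH]; intros Hm.
  - destruct (even_odd_sum_0 N (x - / x)) as [-> ->]; simpl; split; field; auto.
  - destruct IH as [IHe IHo]; [lia|].
    assert (Ho : (x - / x) * (x + / x) * odd_sum N (S m) (x - / x)
      = x ^ (2 * S m) - / x ^ (2 * S m)).
    { rewrite odd_sum_step, Rmult_plus_distr_l, IHo, Rmult_assoc, IHe.
      replace (2 * S m)%nat with (2 * m + 2)%nat by lia.
      rewrite !pow_add; field; split; auto using pow_nonzero. }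
    split; [|exact Ho].
    rewrite even_sum_step, Rmult_plus_distr_l, IHe by lia.
    replace ((x + / x) * _) with
      ((x - / x) * ((x - / x) * (x + / x) * odd_sum N (S m) (x - / x))) by ring.
    rewrite Ho.
    replace (2 * S m + 1)%nat with (2 * m + 1 + 2)%nat by lia.
    replace (2 * S m)%nat with (2 * m + 1 + 1)%nat by lia.
    rewrite !pow_add; field; split; auto using pow_nonzero.
Qed.

(** * Integrals over the half-line through global antiderivatives *)

(** This encodes that the integral of [g] from 0 to infinity is [l]. The antiderivative is kept as a
    function on all of R because it is later composed with [x - / x]. *)
Definition has_antiderivative_lim (g : R -> R) (l : R) : Prop :=
  exists G : R -> R,
    G 0 = 0 /\ (forall t, is_derive G t (g t)) /\ is_lim G p_infty l.

Lemma has_antiderivative_lim_ext g h l k :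
  (forall t, g t = h t) -> l = k ->
  has_antiderivative_lim g l -> has_antiderivative_lim h k.
Proof.
  intros E <- (G & H0 & HD & HL); exists G; split; [|split]; auto.
  intros t; rewrite <- E; apply HD.
Qed.

Lemma has_antiderivative_lim_lincomb c d g h l k :
  has_antiderivative_lim g l -> has_antiderivative_lim h k ->
  has_antiderivative_lim (fun t => c * g t + d * h t) (c * l + d * k).
Proof.
  intros (G & G0 & GD & GL) (H & H0 & HD & HL).
  exists (fun t => c * G t + d * H t); split; [|split].
  - rewrite G0, H0; ring.
  - intros t; apply (is_derive_plus (fun t => c * G t) (fun t => d * H t));
      now apply is_derive_scal.
  - apply is_lim_plus'; [apply (is_lim_scal_l G c _ l)|apply (is_lim_scal_l H d _ k)];
      assumption.
Qed.

Lemma has_antiderivative_lim_sum (c l : nat -> R) (g : nat -> R -> R) N :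
  (forall j, (j <= N)%nat -> has_antiderivative_lim (g j) (l j)) ->
  has_antiderivative_lim (fun t => sum_f_R0 (fun j => c j * g j t) N)
    (sum_f_R0 (fun j => c j * l j) N).
Proof.
  induction N as [|N IH]; intros H.
  (* A single scaled term is a linear combination with second coefficient 0. *)
  - eapply has_antiderivative_lim_ext;
      [| | exact (has_antiderivative_lim_lincomb (c 0%nat) 0 _ _ _ _
             (H 0%nat (le_n _)) (H 0%nat (le_n _)))];
      intros; simpl; ring.
  - eapply has_antiderivative_lim_ext;
      [| | exact (has_antiderivative_lim_lincomb 1 (c (S N)) _ _ _ _
             (IH (fun j Hj => H j (Nat.le_le_succ_r _ _ Hj))) (H (S N) (le_n _)))];
      intros; simpl; ring.
Qed.

(** * Wallis-type integrals and their match with the terms of [P] *)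

Lemma is_lim_Rinv_p_infty : is_lim Rinv p_infty 0.
Proof. apply (is_lim_inv _ _ p_infty); [apply is_lim_id | discriminate]. Qed.

Lemma has_antiderivative_lim_atan b : 0 < b ->
  has_antiderivative_lim (fun t => / (t ^ 2 + b)) (PI / (2 * sqrt b)).
Proof.
  intros Hb; assert (Hs := sqrt_lt_R0 b Hb).
  exists (fun t => / sqrt b * atan (t / sqrt b)); split; [|split].
  - unfold Rdiv; rewrite Rmult_0_l, atan_0; ring.
  - intros t.
    assert (Hd : is_derive atan (t / sqrt b) (/ (1 + (t / sqrt b) ^ 2))).
    { apply is_derive_Reals, derivable_pt_lim_atan. }
    apply (is_derive_ext (fun t => scal (/ sqrt b) (atan (t / sqrt b)))); [reflexivity|].
    replace (/ (t ^ 2 + b)) with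
      (/ sqrt b * (/ sqrt b * / (1 + (t / sqrt b) ^ 2))).
    + apply is_derive_scal.
      apply (is_derive_comp atan (fun t => t / sqrt b)); [exact Hd|].
      auto_derive; [lra | field; lra].
    + rewrite <- (sqrt_sqrt b) at 4 by lra; field.
      split; nra.
  - replace (PI / (2 * sqrt b)) with (/ sqrt b * (PI / 2 - 0)) by (field; lra).
    apply (is_lim_scal_l (fun t => atan (t / sqrt b)) (/ sqrt b) p_infty (PI / 2 - 0)).
    (* The complement formula for the arctangent of an inverse turns the limit at infinity into
       continuity of [atan] at 0. *)
    apply is_lim_ext_loc with (fun t => PI / 2 - atan (sqrt b * / t)).
    + exists 0; intros t Ht.
      rewrite <- atan_inv by (apply Rmult_lt_0_compat; auto using Rinv_0_lt_compat).
      f_equal; field; lra.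
    + apply is_lim_minus'; [apply is_lim_const|].
      assert (Hlim : is_lim (fun t => sqrt b * / t) p_infty 0).
      { rewrite <- (Rmult_0_r (sqrt b)).
        apply (is_lim_scal_l Rinv (sqrt b) p_infty 0), is_lim_Rinv_p_infty. }
      rewrite <- atan_0; refine (filterlim_comp _ _ _ _ atan _ _ _ Hlim _).
      apply (@ex_derive_continuous _ R_NormedModule).
      eexists; apply is_derive_atan.
Qed.

(** For [t > 1], [t ^ (2 * j + 2)] is at most [(t ^ 2 + b) ^ (j + d + 1)], so the quotient lies
    between 0 and [/ t]. *)
Lemma is_lim_pow_odd_div b j d : 0 < b ->
  is_lim (fun t => t ^ (2 * j + 1) / (t ^ 2 + b) ^ (j + d + 1)) p_infty 0.
Proof.
  intros Hb.
  apply (is_lim_le_le_loc (fun _ => 0) (fun t => / t)).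
  - exists 1; intros t Ht.
    assert (H0 : 0 < t ^ 2) by (apply pow_lt; lra).
    assert (Hp : 0 < (t ^ 2 + b) ^ (j + d + 1)) by (apply pow_lt; lra).
    split.
    + apply Rdiv_le_0_compat; [apply pow_le; lra | exact Hp].
    + apply Rle_div_l; [exact Hp|].
      apply (Rmult_le_reg_l t); [lra|].
      rewrite <- Rmult_assoc, Rinv_r, Rmult_1_l by lra.
      apply Rle_trans with ((t ^ 2) ^ (j + 1)).
      * rewrite <- pow_mult.
        replace (2 * (j + 1))%nat with (S (2 * j + 1)) by lia; simpl; lra.
      * apply Rle_trans with ((t ^ 2) ^ (j + d + 1)).
        { apply Rle_pow; [|lia]. rewrite <- (pow1 2); apply pow_incr; lra. }
        apply pow_incr; lra.
  - apply is_lim_const.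
  - apply is_lim_Rinv_p_infty.
Qed.

(** Integration by parts: the integrand is the derivative of [t ^ (2 * j + 1) / (t ^ 2 + b) ^ (j + d
    + 1)], which vanishes at 0 and at infinity. It yields the recurrences for the Wallis-type
    integrals. *)
Lemma has_antiderivative_lim_boundary b j d : 0 < b ->
  has_antiderivative_lim
    (fun t => INR (2 * j + 1) * (t ^ (2 * j) / (t ^ 2 + b) ^ (j + d + 1))
      - 2 * INR (j + d + 1) * (t ^ (2 * (j + 1)) / (t ^ 2 + b) ^ (j + d + 2))) 0.
Proof.
  intros Hb; exists (fun t => t ^ (2 * j + 1) / (t ^ 2 + b) ^ (j + d + 1)).
  split; [|split].
  - rewrite pow_i by lia; unfold Rdiv; ring.
  - intros t; change (R_AbsRing : Type) with R in t; assert (Hp : 0 < t ^ 2 + b) by (pose proof (pow2_ge_0 t); lra).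
    auto_derive.
    + apply pow_nonzero; simpl in Hp; lra.
    + replace (j + (j + 0) + 1)%nat with (S (2 * j)) by lia.
      replace (2 * j + 1)%nat with (S (2 * j)) by lia.
      replace (j + d + 1)%nat with (S (j + d)) by lia.
      replace (j + d + 2)%nat with (S (S (j + d))) by lia.
      replace (2 * (j + 1))%nat with (S (S (2 * j))) by lia.
      rewrite !Nat.pred_succ.
      replace (t * (t * 1) + b) with (t ^ 2 + b) by (simpl; ring).
      set (n1 := INR (S (2 * j))); set (n2 := INR (S (j + d))).
      set (q := t ^ 2 + b) in *.
      rewrite <- !tech_pow_Rmult.
      field; split; [apply Rgt_not_eq, pow_lt; lra | lra].
  - now apply is_lim_pow_odd_div.
Qed.

(** This is [b ^ (-d - 1/2) / 2] times the Beta value B(j + 1/2, d + 1/2), with the Gamma values at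
    half-integers written by factorials. *)
Definition wallis (b : R) (j d : nat) : R :=
  PI / (2 * sqrt b) / b ^ d
  * (INR (fact (2 * j)) * INR (fact (2 * d)))
  / (2 ^ (2 * (j + d)) * INR (fact j) * INR (fact d) * INR (fact (j + d))).

Lemma INR_fact_pos n : 0 < INR (fact n).
Proof. apply lt_0_INR, lt_O_fact. Qed.

Lemma INR_fact_S n : INR (fact (S n)) = (INR n + 1) * INR (fact n).
Proof. now rewrite fact_simpl, mult_INR, S_INR. Qed.

Lemma INR_fact_double_S n : INR (fact (2 * S n))
  = (2 * INR n + 2) * (2 * INR n + 1) * INR (fact (2 * n)).
Proof.
  replace (2 * S n)%nat with (S (S (2 * n))) by lia.
  rewrite !INR_fact_S, S_INR, mult_INR; simpl; ring.
Qed.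

(** Induction on [d] along [j = 0], starting from the arctangent, then on [j] with [d] fixed. *)
Lemma has_antiderivative_lim_wallis b j d : 0 < b ->
  has_antiderivative_lim (fun t => t ^ (2 * j) / (t ^ 2 + b) ^ (j + d + 1))
    (wallis b j d).
Proof.
  intros Hb; assert (Hs := sqrt_lt_R0 b Hb).
  assert (Hq : forall t, 0 < t ^ 2 + b)
    by (intros t; pose proof (pow2_ge_0 t); lra).
  induction j as [|j IHj]; [induction d as [|d IHd]|].
  - eapply has_antiderivative_lim_ext;
      [| | now apply (has_antiderivative_lim_atan b)].
    + intros t; specialize (Hq t); simpl in *; field; lra.
    + unfold wallis; simpl; field; lra.
  - assert (Hd := pos_INR d).
    (* In the boundary term with [j = 0], write [t ^ 2] as [(t ^ 2 + b) - b] and solve for the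
       highest power of [/ (t ^ 2 + b)]. *)
    eapply has_antiderivative_lim_ext;
      [| | apply (has_antiderivative_lim_lincomb
             ((2 * INR d + 1) / (2 * (INR d + 1) * b)) (/ (2 * (INR d + 1) * b)) _ _ _ _
             IHd (has_antiderivative_lim_boundary b 0 d Hb))].
    + intros t; specialize (Hq t); cbv beta.
      replace (0 + S d + 1)%nat with (S (S d)) by lia.
      replace (0 + d + 1)%nat with (S d) by lia.
      replace (0 + d + 2)%nat with (S (S d)) by lia.
      change (2 * 0)%nat with 0%nat; change (2 * (0 + 1))%nat with 2%nat.
      rewrite S_INR; simpl (INR (0 + 1)).
      rewrite <- !(tech_pow_Rmult (t ^ 2 + b)).
      assert (Hp := pow_lt _ d Hq).
      set (q := (t ^ 2 + b) ^ d) in *.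
      field; repeat split; try (simpl in Hq; lra).
    + unfold wallis; rewrite INR_fact_double_S, INR_fact_S.
      replace (2 * (0 + S d))%nat with (2 * d + 2)%nat by lia.
      change (0 + d)%nat with d; change (0 + S d)%nat with (S d).
      rewrite INR_fact_S, pow_add, <- (tech_pow_Rmult b).
      assert (H1 := INR_fact_pos d); assert (H2 := INR_fact_pos (2 * d)).
      assert (H3 : 0 < b ^ d) by now apply pow_lt.
      assert (H4 : 0 < 2 ^ (2 * d)) by (apply pow_lt; lra).
      change (INR (fact 0)) with 1; change (INR (fact (2 * 0))) with 1.
      field; repeat split; lra.
  - assert (Hn := pos_INR (j + d)).
    (* The coefficients come from solving the boundary term for its second quotient. *)
    eapply has_antiderivative_lim_ext;
      [| | apply (has_antiderivative_lim_lincomb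
             ((2 * INR j + 1) / (2 * (INR (j + d) + 1))) (- / (2 * (INR (j + d) + 1))) _ _ _ _
             IHj (has_antiderivative_lim_boundary b j d Hb))].
    + intros t; specialize (Hq t); cbv beta.
      replace (S j + d + 1)%nat with (S (S (j + d))) by lia.
      replace (j + d + 2)%nat with (S (S (j + d))) by lia.
      replace (j + d + 1)%nat with (S (j + d)) by lia.
      replace (2 * (j + 1))%nat with (2 * S j)%nat by lia.
      rewrite (S_INR (j + d)), !plus_INR, mult_INR.
      change (INR 2) with 2; change (INR 1) with 1.
      rewrite plus_INR in Hn.
      rewrite <- !(tech_pow_Rmult (t ^ 2 + b)).
      assert (Hp := pow_lt _ (j + d) Hq).
      set (q := (t ^ 2 + b) ^ (j + d)) in *.
      field; repeat split; try (simpl in Hq; lra).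
    + unfold wallis; rewrite INR_fact_double_S, INR_fact_S.
      replace (2 * (S j + d))%nat with (2 * (j + d) + 2)%nat by lia.
      change (S j + d)%nat with (S (j + d)).
      rewrite INR_fact_S, pow_add.
      assert (Hj := pos_INR j).
      assert (H1 := INR_fact_pos j); assert (H2 := INR_fact_pos d).
      assert (H5 := INR_fact_pos (j + d)).
      assert (H3 : 0 < b ^ d) by now apply pow_lt.
      assert (H4 : 0 < 2 ^ (2 * (j + d))) by (apply pow_lt; lra).
      field; repeat split; lra.
Qed.

(** The factor [(2j)!] cancels; with [d = m - j], the other factorials regroup as [(2d)! / d!^2]
    times [(m+j)! / (j! m!)]. *)
Lemma binom_wallis b m j : 0 < b -> (j <= m)%nat ->
  binom (m + j) (2 * j) * wallis b j (m - j) =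
  PI / (2 * b ^ m * sqrt b) * (/ 2 ^ (2 * m)
    * (Binomial.C (2 * m - 2 * j) (m - j) * Binomial.C (m + j) j * b ^ j)).
Proof.
  intros Hb Hj; destruct (Nat.le_exists_sub _ _ Hj) as (d & -> & _).
  rewrite binom_le by lia; unfold wallis, Binomial.C.
  replace (d + j + j - 2 * j)%nat with d by lia.
  replace (d + j - j)%nat with d by lia.
  replace (2 * (d + j) - 2 * j)%nat with (2 * d)%nat by lia.
  replace (2 * d - d)%nat with d by lia.
  replace (d + j + j - j)%nat with (d + j)%nat by lia.
  rewrite (Nat.add_comm j d), (pow_add b).
  assert (Hs := sqrt_lt_R0 b Hb).
  assert (H1 := INR_fact_pos j); assert (H2 := INR_fact_pos d).
  assert (H5 := INR_fact_pos (d + j)); assert (H6 := INR_fact_pos (2 * j)).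
  assert (H3 : 0 < b ^ d) by now apply pow_lt.
  assert (H7 : 0 < b ^ j) by now apply pow_lt.
  assert (H4 : 0 < 2 ^ (2 * (d + j))) by (apply pow_lt; lra).
  field; repeat split; lra.
Qed.

(** * The reflection of [x] to [/ x], and the prefactor *)

Lemma quartic_pos a x : -1 < a -> 0 < x ^ 4 + 2 * a * x ^ 2 + 1.
Proof.
  intros Ha.
  replace (_ + 1) with ((x ^ 2 - 1) ^ 2 + 2 * (a + 1) * x ^ 2) by ring.
  destruct (Req_dec x 0) as [-> | Hx]; [simpl; lra|].
  assert (0 < x ^ 2) by now apply pow2_gt_0.
  pose proof (pow2_ge_0 (x ^ 2 - 1)); nra.
Qed.

Lemma integrand_reflection a m x : -1 < a -> 0 < x ->
  let f := fun x => 1 / (x ^ 4 + 2 * a * x ^ 2 + 1) ^ (m + 1) in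
  f x + / x ^ 2 * f (/ x) =
  (1 + / x ^ 2) * (even_sum m m (x - / x)
    / ((x - / x) ^ 2 + 2 * (a + 1)) ^ (m + 1)).
Proof.
  intros Ha Hx f; unfold f.
  assert (HQ := quartic_pos a x Ha).
  set (q := x ^ 4 + 2 * a * x ^ 2 + 1) in *.
  replace ((/ x) ^ 4 + _ + 1) with (q / x ^ 4) by (unfold q; field; lra).
  replace ((x - / x) ^ 2 + _) with (q / x ^ 2) by (unfold q; field; lra).
  destruct (even_odd_sum_closed m m x ltac:(lra) ltac:(lia)) as [E _].
  (* Writing [1 + / x ^ 2] as [/ x * (x + / x)] exposes the left side of the Chebyshev-type
     identity. *)
  transitivity (/ x * ((x + / x) * even_sum m m (x - / x)) * / (q / x ^ 2) ^ (m + 1)).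
  2: { unfold Rdiv; generalize (/ (q * / x ^ 2) ^ (m + 1)); intros; field; lra. }
  rewrite E.
  unfold Rdiv; rewrite !Rpow_mult_distr, !pow_inv, <- !pow_mult.
  assert (Hp := pow_lt _ m HQ).
  assert (Hm := pow_lt _ (2 * m) Hx).
  replace (4 * (m + 1))%nat with (2 * m + 2 * m + 4)%nat by lia.
  replace (2 * (m + 1))%nat with (2 * m + 2)%nat by lia.
  rewrite !pow_add.
  field; repeat split; lra.
Qed.

(** Once a factor 2 is split off, both exponents are [INR m + / 2] and the bases merge. The result
    is the denominator appearing in [binom_wallis]. *)
Lemma prefactor_eq m a : -1 < a ->
  Rpower 2 (INR m + 3 / 2) * Rpower (a + 1) (INR m + 1 / 2)
  = 2 * (2 * (a + 1)) ^ m * sqrt (2 * (a + 1)).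
Proof.
  intros Ha.
  replace (INR m + 3 / 2) with (1 + (INR m + / 2)) by field.
  replace (INR m + 1 / 2) with (INR m + / 2) by field.
  rewrite Rpower_plus, Rpower_1, Rmult_assoc by lra.
  rewrite Rpower_mult_distr, Rpower_plus, Rpower_pow, Rpower_sqrt by lra.
  ring.
Qed.

(** * The improper integral as a limit of the antiderivative *)

Lemma is_RInt_gen_0_infty (f F : R -> R) (l : R) :
  (forall x, continuous f x) -> (forall x, is_derive F x (f x)) -> F 0 = 0 ->
  is_lim F p_infty l -> is_RInt_gen f (at_point 0) (Rbar_locally p_infty) l.
Proof.
  intros Hf HF F0 HL S HS.
  apply (Filter_prod _ _ _ (fun x => x = 0) (fun y => S (F y)));
    [reflexivity | exact (HL S HS)|].
  intros x y -> Hy; exists (F y); split; [|exact Hy].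
  evar_last; [apply (is_RInt_derive F f); auto|].
  simpl; rewrite F0; unfold minus, plus, opp; simpl; ring.
Qed.

(** As [x] grows, [/ x] tends to 0, where [F] is continuous with value 0, and [x - / x] tends to
    infinity. Convergence of [F] is thus a conclusion, not an assumption. *)
Lemma is_lim_of_reflection (F H : R -> R) (l : R) :
  continuous F 0 -> F 0 = 0 ->
  (forall x, 1 < x -> F x = F (/ x) + H (x - / x)) ->
  is_lim H p_infty l -> is_lim F p_infty l.
Proof.
  intros HF F0 E HL.
  assert (Hinv := is_lim_Rinv_p_infty).
  apply is_lim_ext_loc with (fun x => F (/ x) + H (x - / x)).
  - exists 1; intros x Hx; symmetry; now apply E.
  - replace l with (0 + l) by ring.
    apply is_lim_plus'.
    + rewrite <- F0; exact (filterlim_comp _ _ _ _ F _ _ _ Hinv HF).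
    + apply (is_lim_comp H (fun x => x - / x) p_infty l p_infty HL).
      * eapply is_lim_minus; [apply is_lim_id | exact Hinv | reflexivity].
      * exists 0; discriminate.
Qed.

Theorem mainTheorem1 (m : nat) (a : R) (ha : -1 < a) :
  is_RInt_gen (fun x : R => 1 / (x ^ 4 + 2 * a * x ^ 2 + 1) ^ (m + 1))
    (at_point 0) (Rbar_locally p_infty)
    (PI / (Rpower 2 (INR m + 3 / 2) * Rpower (a + 1) (INR m + 1 / 2)) * P m a).
Proof.
  set (f := fun x : R => _).
  set (b := 2 * (a + 1)); assert (Hb : 0 < b) by (unfold b; lra).
  assert (Hf : forall x, continuous f x).
  { intros x; apply (@ex_derive_continuous _ R_NormedModule); unfold f.
    auto_derive; apply pow_nonzero.
    pose proof (quartic_pos a x ha) as Hq; simpl in Hq; lra. }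
  assert (HF : forall x, is_derive (RInt f 0) x (f x)).
  { intros x; apply is_derive_RInt with 0; [|apply Hf].
    apply filter_forall; intros y.
    apply (@RInt_correct R_CompleteNormedModule),
      (@ex_RInt_continuous R_CompleteNormedModule); auto. }
  assert (F0 : RInt f 0 0 = 0) by exact (@RInt_point R_CompleteNormedModule 0 f).
  assert (Hl : has_antiderivative_lim
    (fun t => even_sum m m t / (t ^ 2 + b) ^ (m + 1))
    (PI / (Rpower 2 (INR m + 3 / 2) * Rpower (a + 1) (INR m + 1 / 2)) * P m a)).
  { eapply has_antiderivative_lim_ext;
      [| | apply (has_antiderivative_lim_sum
             (fun j => binom (m + j) (2 * j)) (fun j => wallis b j (m - j))
             (fun j t => t ^ (2 * j) / (t ^ 2 + b) ^ (m + 1)) m)].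
    - intros t; unfold even_sum, Rdiv at 2; rewrite Rmult_comm, scal_sum.
      apply sum_eq; intros; unfold Rdiv; ring.
    - rewrite prefactor_eq by lra; fold b; unfold P.
      rewrite !scal_sum; apply sum_eq; intros j Hj.
      (* The power [b ^ j] supplies both [2 ^ j] and [(a + 1) ^ j] in the summand of [P]. *)
      rewrite binom_wallis by auto; unfold b; rewrite (Rpow_mult_distr 2 _ j); ring.
    - intros j Hj; eapply has_antiderivative_lim_ext;
        [| reflexivity | now apply has_antiderivative_lim_wallis].
      intros t; now replace (j + (m - j) + 1)%nat with (m + 1)%nat by lia. }
  destruct Hl as (H & H0 & HD & HL).
  apply (is_RInt_gen_0_infty f (RInt f 0)); auto.
  apply (is_lim_of_reflection (RInt f 0) H); auto.
  { apply (@ex_derive_continuous _ R_NormedModule); exists (f 0); auto. }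
  intros x Hx.
  (* [D] has derivative 0 on [[1, x]], and it vanishes at 1 because 1 is fixed by inversion and
     [H 0 = 0]. *)
  set (D := fun y => RInt f 0 y - RInt f 0 (/ y) - H (y - / y)).
  enough (E : D 1 = D x).
  { unfold D in E; rewrite Rinv_1, Rminus_diag, Rminus_diag, H0 in E; lra. }
  apply (eq_is_derive D); [|exact Hx].
  intros y [Hy _].
  assert (Hinv : is_derive Rinv y (- / y ^ 2)).
  { auto_derive; [lra | field; lra]. }
  unfold D; evar_last.
  - apply (is_derive_minus (fun y => RInt f 0 y - RInt f 0 (/ y)) (fun y => H (y - / y))).
    + apply (is_derive_minus (RInt f 0) (fun y => RInt f 0 (/ y))); [apply HF|].
      apply (is_derive_comp (RInt f 0) Rinv); [apply HF | exact Hinv].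
    + apply (is_derive_comp H (fun y => y - / y)); [apply HD|].
      apply (is_derive_minus (fun y => y) Rinv); [apply is_derive_id | exact Hinv].
  - assert (E := integrand_reflection a m y ha ltac:(lra)); cbv zeta in E.
    fold f in E; fold b in E.
    set (w := even_sum m m (y - / y) / ((y - / y) ^ 2 + b) ^ (m + 1)) in *.
    (* The derivative of [D] is the difference of the two sides of the reflection identity [E]. *)
    change (f y + - (- / y ^ 2 * f (/ y)) + - ((1 + - - / y ^ 2) * w) = 0).
    lra.
Qed.
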